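(* The subvariety of the variety $\mathbb{UMTL}$ of UMTL-algebras determined by the equation $$(x\rightarrow y)\rightarrow y=(y\rightarrow x)\rightarrow x$$ is term-equivalent to the variety $\mathbb{UMV}$ of UMV-algebras.
   Context: An MTL-algebra is a structure $(L,\wedge,\vee,\odot,\rightarrow,0,1)$ such that $(L,\wedge,\vee,0,1)$ is a bounded lattice (with order $\le$), $(L,\odot,1)$ is a commutative monoid, $x\odot y\leq z$ iff $x\leq y\rightarrow z$, and $(x\rightarrow y)\vee(y\rightarrow x)=1$ for all $x,y,z\in L$. A UMTL-algebra (MTL-algebra with a universal quantifier) is a structure $(L,\forall)=(L,\wedge,\vee,\odot,\rightarrow,0,1,\forall)$ where $(L,\wedge,\vee,\odot,\rightarrow,0,1)$ is an MTL-algebra and $\forall:L\to L$ is a unary operation satisfying, for all $x,y\in L$: (U1) $\forall x\leq x$; (U2) $\forall((x\rightarrow \forall y)\rightarrow \forall y)=(\forall x\rightarrow \forall y)\rightarrow \forall y$; (U3) $\forall(\forall x\rightarrow y)=\forall x\rightarrow\forall y$. The variety of UMTL-algebras is denoted $\mathbb{UMTL}$. An MV-algebra is an MTL-algebra satisfying $(x\rightarrow y)\rightarrow y=(y\rightarrow x)\rightarrow x$. A UMV-algebra (MV-algebra with a universal quantifier) is an algebra $(A,\wedge,\vee,\rightarrow,\odot,\forall,0,1)$ such that $(A,\wedge,\vee,\rightarrow,\odot,0,1)$ is an MV-algebra and $\forall$ satisfies: $\forall 1=1$; $\forall x\leq x$; $\forall(x\vee \forall y)=\forall x\vee \forall y$;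 $\forall(x\rightarrow y)\rightarrow (\forall x\rightarrow \forall y)=1$; $\forall(\forall x\rightarrow \forall y)=\forall x\rightarrow \forall y$. The variety of UMV-algebras is denoted $\mathbb{UMV}$. *)

(* Defs.v *)
From mathcomp Require Import all_boot.
Set Implicit Arguments.
Unset Strict Implicit.
Unset Printing Implicit Defensive.

Record signature : Type := Signature { symbol :> Type; arity : symbol -> nat }.

Record algebra (S : signature) : Type := Algebra {
  carrier :> Type;
  op : forall o : S, ('I_(arity o) -> carrier) -> carrier }.

Inductive term (S : signature) (X : Type) : Type :=
  | Var of X
  | App (o : S) of ('I_(arity o) -> term S X).

Fixpoint eval (S : signature) (A : algebra S) (X : Type) (v : X -> A)
    (t : term S X) : A :=
  match t with
  | Var x => v x
  | App o args => op (fun i => eval v (args i))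
  end.

Definition equation (S : signature) : Type := (term S nat * term S nat)%type.

Definition satisfies (S : signature) (A : algebra S) (e : equation S) : Prop :=
  forall v : nat -> A, eval v e.1 = eval v e.2.

Definition algebra_class (S : signature) : Type := algebra S -> Prop.

Definition subclass_of_eq (S : signature) (K : algebra_class S)
    (e : equation S) : algebra_class S :=
  fun A => K A /\ satisfies A e.

Definition interpretation (S1 S2 : signature) : Type :=
  forall o : S1, term S2 'I_(arity o).

Definition derived (S1 S2 : signature) (t : interpretation S1 S2)
    (B : algebra S2) : algebra S1 :=
  @Algebra S1 B (fun o args => eval args (t o)).

(** [A] and [derived s (derived t A)] have the same carrier definitionally, so
    equality of these algebras is stated as pointwise equality of operations. *)
Definition roundtrip (S1 S2 : signature) (t : interpretation S2 S1)
    (s : interpretation S1 S2) (A : algebra S1) : Prop :=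
  forall (o : S1) (args : 'I_(arity o) -> A),
    @op S1 (derived s (derived t A)) o args = @op S1 A o args.

Definition term_equivalent (S1 S2 : signature) (K1 : algebra_class S1)
    (K2 : algebra_class S2) : Prop :=
  exists (t : interpretation S2 S1) (s : interpretation S1 S2),
    [/\ forall A : algebra S1, K1 A -> K2 (derived t A),
        forall B : algebra S2, K2 B -> K1 (derived s B),
        forall A : algebra S1, K1 A -> roundtrip t s A
      & forall B : algebra S2, K2 B -> roundtrip s t B].

Inductive usymbol : Type := Meet | Join | Mul | Imp | Zero | One | Forall.

Definition uarity (o : usymbol) : nat :=
  match o with
  | Meet | Join | Mul | Imp => 2
  | Zero | One => 0
  | Forall => 1
  end.

Definition usig : signature := Signature uarity.

Definition meet (A : algebra usig) (x y : A) : A :=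
  @op usig A Meet (tnth [tuple x; y]).
Definition join (A : algebra usig) (x y : A) : A :=
  @op usig A Join (tnth [tuple x; y]).
Definition mul (A : algebra usig) (x y : A) : A :=
  @op usig A Mul (tnth [tuple x; y]).
Definition imp (A : algebra usig) (x y : A) : A :=
  @op usig A Imp (tnth [tuple x; y]).
Definition zero (A : algebra usig) : A := @op usig A Zero (tnth [tuple]).
Definition one (A : algebra usig) : A := @op usig A One (tnth [tuple]).
Definition all_ (A : algebra usig) (x : A) : A :=
  @op usig A Forall (tnth [tuple x]).

Definition le (A : algebra usig) (x y : A) : Prop := meet x y = x.

Declare Scope ualg_scope.
Delimit Scope ualg_scope with U.
Local Open Scope ualg_scope.

Notation "x `&` y" := (meet x y) (at level 48, left associativity) : ualg_scope.
Notation "x `|` y" := (join x y) (at level 52, left associativity) : ualg_scope.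
Notation "x `*` y" := (mul x y) (at level 46, left associativity) : ualg_scope.
Notation "x ~> y" := (imp x y) (at level 55, right associativity) : ualg_scope.
Notation "x <=u y" := (le x y) (at level 70, no associativity) : ualg_scope.

Record bounded_lattice_axioms (A : algebra usig) : Prop := {
  meetC : forall x y : A, x `&` y = y `&` x;
  meetA : forall x y z : A, x `&` (y `&` z) = (x `&` y) `&` z;
  joinC : forall x y : A, x `|` y = y `|` x;
  joinA : forall x y z : A, x `|` (y `|` z) = (x `|` y) `|` z;
  meetKj : forall x y : A, x `&` (x `|` y) = x;
  joinKm : forall x y : A, x `|` (x `&` y) = x;
  le0 : forall x : A, zero A <=u x;
  le1 : forall x : A, x <=u one A }.

(** [A] has the full signature; only its reduct without [Forall] is constrained. *)
Record is_MTL (A : algebra usig) : Prop := {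
  mtl_lattice : bounded_lattice_axioms A;
  mulA : forall x y z : A, x `*` (y `*` z) = (x `*` y) `*` z;
  mulC : forall x y : A, x `*` y = y `*` x;
  mul1 : forall x : A, x `*` one A = x;
  residuation : forall x y z : A, x `*` y <=u z <-> x <=u (y ~> z);
  prelinearity : forall x y : A, (x ~> y) `|` (y ~> x) = one A }.

Record UMTL (A : algebra usig) : Prop := {
  umtl_mtl : is_MTL A;
  U1 : forall x : A, all_ x <=u x;
  U2 : forall x y : A,
    all_ ((x ~> all_ y) ~> all_ y) = (all_ x ~> all_ y) ~> all_ y;
  U3 : forall x y : A, all_ (all_ x ~> y) = all_ x ~> all_ y }.

Definition tImp (s t : term usig nat) : term usig nat :=
  @App usig nat Imp (tnth [tuple s; t]).

Definition mv_equation : equation usig :=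
  let x := Var usig 0 in let y := Var usig 1 in
  (tImp (tImp x y) y, tImp (tImp y x) x).

Definition is_MV : algebra_class usig := subclass_of_eq is_MTL mv_equation.

Record UMV (A : algebra usig) : Prop := {
  umv_mv : is_MV A;
  all1 : all_ (one A) = one A;
  all_le : forall x : A, all_ x <=u x;
  all_join : forall x y : A, all_ (x `|` all_ y) = all_ x `|` all_ y;
  all_imp : forall x y : A, all_ (x ~> y) ~> (all_ x ~> all_ y) = one A;
  all_imp_all : forall x y : A, all_ (all_ x ~> all_ y) = all_ x ~> all_ y }.

(* Main.v *)
From Stdlib Require Import FunctionalExtensionality.
From mathcomp Require Import all_boot.
Require Import Defs.

(** Both varieties have the same signature, so the equivalence is realised by
    the identity translation, and all the content lies in showing that over an
    MV-algebra the axioms [U1], [U2], [U3] and the UMV axioms say the same thing about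
    the quantifier.

    The link is that in an MV-algebra the term [(x ~> y) ~> y] is the join of
    [x] and [y] ([join_imp]).  Read through this identity, [U2] is exactly the
    UMV axiom on [all_ (x `|` all_ y)].  The rest is residuation.

    From UMTL to UMV, [U3] applied to [all_ x ~> x = 1] gives [all_ 1 = 1], and
    [U2] at [x = 0] gives idempotence of [all_], which turns [U3] into
    [all_imp_all].  For [all_imp], put [z = all_ (x ~> y)]: from [z <= x ~> y]
    we get [all_ x <= z ~> y], and [U3], which moves the quantifier past the
    quantified antecedents [all_ x] and [z], yields [all_ x <= z ~> all_ y].

    From UMV to UMTL, [all_imp] at [all_ x] with idempotence gives one
    inequality of [U3], and monotonicity applied to
    [all_ x ~> all_ y <= all_ x ~> y] together with [all_imp_all] the other. *)

Set Implicit Arguments.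
Unset Strict Implicit.
Unset Printing Implicit Defensive.
Local Open Scope ualg_scope.

(** * The lattice order *)

Section LatticeOrder.
Variables (A : algebra usig) (latA : bounded_lattice_axioms A).
Implicit Types x y z : A.

Lemma le_refl x : x <=u x.
Proof. by have := meetKj latA x (x `&` x); rewrite (joinKm latA). Qed.

Lemma le_trans y x z : x <=u y -> y <=u z -> x <=u z.
Proof. by rewrite /le => xy yz; rewrite -xy -(meetA latA) yz. Qed.

Lemma le_antisym x y : x <=u y -> y <=u x -> x = y.
Proof. by rewrite /le => xy yx; rewrite -xy (meetC latA). Qed.

Lemma le_join x y : x <=u y <-> x `|` y = y.
Proof.
split=> [xy|<-]; last exact: meetKj latA x y.
by rewrite -xy (joinC latA) (meetC latA) (joinKm latA).
Qed.

Lemma le_joinl x y : x <=u x `|` y.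
Proof. exact: meetKj latA x y. Qed.

Lemma le_joinr x y : y <=u x `|` y.
Proof. by rewrite (joinC latA); exact: le_joinl. Qed.

Lemma join_lub x y z : x <=u z -> y <=u z -> x `|` y <=u z.
Proof.
by move=> /le_join xz /le_join yz; apply/le_join; rewrite -(joinA latA) yz.
Qed.

End LatticeOrder.

(** * Residuation in MTL-algebras *)

Section Residuation.
Variables (A : algebra usig) (mtlA : is_MTL A).
Implicit Types x y z : A.
Let latA := mtl_lattice mtlA.

Lemma imp_eq1 x y : x ~> y = one A <-> x <=u y.
Proof.
split=> [xy1|xy].
  rewrite -[x](mul1 mtlA) (mulC mtlA); apply/(residuation mtlA).
  by rewrite xy1; exact: le_refl.
apply: (le_antisym latA); first exact: le1 latA _.
by apply/(residuation mtlA); rewrite (mulC mtlA) (mul1 mtlA).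
Qed.

Lemma imp1 x : one A ~> x = x.
Proof.
apply: (le_antisym latA); last first.
  by apply/(residuation mtlA); rewrite (mul1 mtlA); exact: le_refl.
rewrite -[_ ~> x](mul1 mtlA); apply/(residuation mtlA); exact: le_refl.
Qed.

Lemma imp_refl x : x ~> x = one A.
Proof. by apply/imp_eq1; exact: le_refl. Qed.

Lemma le_imp_exchange x y z : x <=u (y ~> z) -> y <=u (x ~> z).
Proof.
by move/(residuation mtlA)=> h; apply/(residuation mtlA); rewrite (mulC mtlA).
Qed.

Lemma le_double_imp x y : x <=u ((x ~> y) ~> y).
Proof. exact/le_imp_exchange/le_refl. Qed.

Lemma le_imp x y : y <=u (x ~> y).
Proof.
by apply: le_imp_exchange; rewrite imp_refl; exact: le1 latA _.
Qed.

Lemma imp_antitone x y z : x <=u y -> (y ~> z) <=u (x ~> z).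
Proof.
by move=> xy; apply: le_imp_exchange; apply: (le_trans latA xy) (le_double_imp _ _).
Qed.

Lemma imp_monotone x y z : y <=u z -> (x ~> y) <=u (x ~> z).
Proof.
move=> yz; apply/(residuation mtlA); apply: (le_trans latA) yz.
by apply/(residuation mtlA); exact: le_refl.
Qed.

End Residuation.

(** * MV-algebras *)

(** Not a conversion: the argument functions [fun i => eval v (tnth _ i)] and
    [tnth [tuple eval v s; eval v t]] agree only pointwise. *)
Lemma eval_tImp (A : algebra usig) (v : nat -> A) s t :
  eval v (tImp s t) = (eval v s ~> eval v t).
Proof.
rewrite /imp /=; congr (op _); apply: functional_extensionality => i.
by case: i => [[|[|i]] lti]; rewrite ?(tnth_nth (eval v s)) ?(tnth_nth s).
Qed.

Lemma mv_equationE (A : algebra usig) :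
  satisfies A mv_equation <->
  forall x y : A, ((x ~> y) ~> y) = ((y ~> x) ~> x).
Proof.
split=> [mvA x y|mvA v]; last by rewrite !eval_tImp /=.
have := mvA (fun n => if n is 0 then x else y).
by rewrite !eval_tImp.
Qed.

(** [(x ~> y) ~> y] is an upper bound in any MTL-algebra.  It is least because
    the map [x |-> (x ~> y) ~> y] is monotone, and at an upper bound [u] of [y]
    the MV equation evaluates it to [(y ~> u) ~> u = u]. *)
Lemma join_imp (A : algebra usig) (mvA : is_MV A) (x y : A) :
  x `|` y = ((x ~> y) ~> y).
Proof.
have [mtlA /mv_equationE mvE] := mvA; have latA := mtl_lattice mtlA.
apply: (le_antisym latA).
  by apply: (join_lub latA); [exact: le_double_imp | exact: le_imp].
set u := x `|` y.
have y_le_u : y <=u u by exact: le_joinr.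
have uE : ((u ~> y) ~> y) = u by rewrite mvE (imp_eq1 mtlA y u).2 // imp1.
by rewrite -[X in _ <=u X]uE; do 2!apply: (imp_antitone mtlA); exact: le_joinl.
Qed.

(** * The two axiomatisations of the quantifier *)

Section FromUMTL.
Variables (A : algebra usig) (uA : UMTL A).
Implicit Types x y : A.
Let mtlA := umtl_mtl uA.
Let latA := mtl_lattice mtlA.

Lemma umtl_all1 : all_ (one A) = one A.
Proof.
rewrite -{1}((imp_eq1 mtlA _ _).2 (U1 uA (one A))) (U3 uA).
exact: imp_refl.
Qed.

(** At [x = 0] both sides of [U2] collapse, because [0 ~> y = 1] and
    [1 ~> y = y]: what remains is [all_ (all_ y) = all_ y]. *)
Lemma umtl_all_idem x : all_ (all_ x) = all_ x.
Proof.
have zero_imp y : zero A ~> y = one A.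
  by apply/(imp_eq1 mtlA); exact: le0 latA _.
have all0 : all_ (zero A) = zero A.
  by apply: (le_antisym latA); [exact: U1 uA _ | exact: le0 latA _].
by have := U2 uA (zero A) x; rewrite all0 zero_imp (imp1 mtlA).
Qed.

(** [U3] lets the quantifier act on the consequent alone once the antecedent is
    quantified.  Both [all_ x] and [z] below are, so each can play the role of
    the antecedent in turn, exchanging them by residuation. *)
Lemma umtl_all_imp x y : all_ (x ~> y) ~> (all_ x ~> all_ y) = one A.
Proof.
set z := all_ (x ~> y).
have x_le : all_ x <=u (z ~> y).
  apply: (le_trans latA (U1 uA x)); apply: (le_imp_exchange mtlA).
  exact: U1 uA (x ~> y).
apply/(imp_eq1 mtlA); apply: (le_imp_exchange mtlA).
rewrite -(U3 uA); apply/(imp_eq1 mtlA).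
by rewrite -(U3 uA) ((imp_eq1 mtlA _ _).2 x_le) umtl_all1.
Qed.

Lemma UMTL_UMV : satisfies A mv_equation -> UMV A.
Proof.
move=> mvE; have mvA : is_MV A by [].
split=> //; first exact: umtl_all1.
- exact: U1 uA.
- by move=> x y; rewrite !(join_imp mvA) (U2 uA).
- exact: umtl_all_imp.
- by move=> x y; rewrite (U3 uA) umtl_all_idem.
Qed.

End FromUMTL.

Section FromUMV.
Variables (A : algebra usig) (uA : UMV A).
Implicit Types x y : A.
Let mvA := umv_mv uA.
Let mtlA := mvA.1.
Let latA := mtl_lattice mtlA.

Lemma umv_all_idem x : all_ (all_ x) = all_ x.
Proof. by have := all_imp_all uA (one A) x; rewrite (all1 uA) !(imp1 mtlA). Qed.

Lemma umv_all_monotone x y : x <=u y -> all_ x <=u all_ y.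
Proof.
move=> /(imp_eq1 mtlA) xy; apply/(imp_eq1 mtlA).
by have := all_imp uA x y; rewrite xy (all1 uA) (imp1 mtlA).
Qed.

Lemma umv_all_imp_all x y : all_ (all_ x ~> y) = all_ x ~> all_ y.
Proof.
apply: (le_antisym latA).
  by apply/(imp_eq1 mtlA); rewrite -{2}(umv_all_idem x); exact: all_imp uA _ _.
rewrite -(all_imp_all uA); apply: umv_all_monotone.
by apply: (imp_monotone mtlA); exact: all_le uA y.
Qed.

Lemma UMV_UMTL : UMTL A.
Proof.
split; first exact: mtlA.
- exact: all_le uA.
- by move=> x y; rewrite -!(join_imp mvA) (all_join uA).
- exact: umv_all_imp_all.
Qed.

End FromUMV.

(** * Term equivalence *)

Definition id_interpretation (S : signature) : interpretation S S :=
  fun o => App (fun i => Var S i).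

(** Evaluating [App o Var] gives back [op] by eta, so the derived algebra is the
    original one as soon as the latter is a constructor.  For the same reason
    both round trips hold by computation. *)
Lemma derived_id (S : signature) (A : algebra S) :
  derived (@id_interpretation S) A = A.
Proof. by case: A. Qed.

Theorem theorem3p5 : term_equivalent (subclass_of_eq UMTL mv_equation) UMV.
Proof.
exists (@id_interpretation usig), (@id_interpretation usig); split.
- by move=> A [uA mvE]; rewrite derived_id; exact: UMTL_UMV.
- move=> B uB; rewrite derived_id; split; first exact: UMV_UMTL.
  exact: (umv_mv uB).2.
- by [].
- by [].
Qed.
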